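(* Let $v=h+\bar g$ be a harmonic mapping on the unit disk $\mathbb{D}$, and let $u$ be the corresponding real kernel $\alpha$-harmonic mapping of $v$ on $\mathbb{D}$. If $v$ is Lipschitz continuous on $\mathbb{D}$ and $\frac{\alpha}{2}=p-1$ is a nonnegative integer, then $u$ is Lipschitz continuous on $\mathbb{D}$ as well.
   Context: $\mathbb{D}$ is the open unit disk in $\mathbb{C}$. $F(a,b;c;x)=\sum_{n=0}^{\infty}\frac{(a)_n(b)_n}{(c)_n}\frac{x^n}{n!}$ ($|x|<1$) is the Gauss hypergeometric function, where $(a)_0=1$ and $(a)_n=a(a+1)\cdots(a+n-1)$ for $n\ge1$. A harmonic mapping on $\mathbb{D}$ is written $v(z)=h(z)+\overline{g(z)}=\sum_{k=0}^{\infty}c_{k}z^{k}+\sum_{k=1}^{\infty}c_{-k}\bar{z}^{k}$ with $h,g$ holomorphic in $\mathbb{D}$. For $\alpha>-1$, the corresponding real kernel $\alpha$-harmonic mapping of $v$ is $$u(z)=\sum_{k=0}^{\infty}c_{k}F\left(-\tfrac{\alpha}{2},k-\tfrac{\alpha}{2};k+1;|z|^{2}\right)z^{k}+\sum_{k=1}^{\infty}c_{-k}F\left(-\tfrac{\alpha}{2},k-\tfrac{\alpha}{2};k+1;|z|^{2}\right)\bar{z}^{k},\quad z\in\mathbb{D}.$$ *)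

(* Defs.v *)
From Stdlib Require Import Reals ZArith.
From Coquelicot Require Import Coquelicot.

Open Scope R_scope.

Definition in_disk (z : C) : Prop := Cmod z < 1.

Definition lipschitz_on_disk (f : C -> C) : Prop :=
  exists L : R, 0 <= L /\
    forall z w : C, in_disk z -> in_disk w ->
      Cmod (f z - f w)%C <= L * Cmod (z - w)%C.

(* At type [C -> C], [ex_derive] is the complex derivative, i.e.
   differentiability over [C_AbsRing]. *)
Definition holomorphic_on_disk (f : C -> C) : Prop :=
  forall z : C, in_disk z ->
    @ex_derive C_AbsRing C_NormedModule f z.

Fixpoint pochhammer (a : R) (n : nat) : R :=
  match n with
  | O => 1
  | S m => pochhammer a m * (a + INR m)
  end.

(* [PSeries] is total: this is F(a,b;c;x) for |x| < 1 and c not in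
   {0, -1, -2, ...}. *)
Definition hypergeom (a b c x : R) : R :=
  PSeries (fun n => pochhammer a n * pochhammer b n
                    / (pochhammer c n * INR (fact n))) x.

(* Total sum of a complex series, the analogue over [C] of [Series]; it is
   the sum whenever the series converges, see [is_series_CSeries]. *)
Definition CSeries (a : nat -> C) : C :=
  (Series (fun n => Re (a n)), Series (fun n => Im (a n))).

Lemma is_series_CSeries (a : nat -> C) (l : C) :
  @is_series C_AbsRing C_NormedModule a l -> CSeries a = l.
Proof.
intros H.
assert (Hs : forall n, sum_n a n
  = (sum_n (fun k => Re (a k)) n, sum_n (fun k => Im (a k)) n)).
{ induction n as [|n IH].
  - rewrite sum_O, 2 sum_O; unfold Re, Im; apply surjective_pairing.
  - rewrite sum_Sn, IH, 2 sum_Sn; destruct (a (S n)); reflexivity. }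
assert (Hb := proj1 (filterlim_locally (U := C_UniformSpace) _ _) H).
destruct l as [lr li]; unfold CSeries; f_equal;
  apply is_series_unique; apply filterlim_locally; intros eps;
  generalize (Hb eps); apply filter_imp; intros n Hn; rewrite Hs in Hn;
  apply Hn.
Qed.

(* The doubly infinite coefficient sequence (c_k) of the expansion is indexed
   by [Z].  The constant term g(0) may be nonzero: it is then absorbed in c_0. *)
Definition harmonic_mapping (h g v : C -> C) (c : Z -> C) : Prop :=
  holomorphic_on_disk h /\
  holomorphic_on_disk g /\
  (forall z : C, in_disk z -> v z = (h z + Cconj (g z))%C) /\
  (forall z : C, in_disk z ->
     exists s t : C,
       @is_series C_AbsRing C_NormedModule
         (fun k => (c (Z.of_nat k) * z ^ k)%C) s /\
       @is_series C_AbsRing C_NormedModule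
         (fun j => (c (- Z.of_nat (S j))%Z * Cconj z ^ S j)%C) t /\
       v z = (s + t)%C).

Definition kernel_factor (alpha : R) (k : nat) (z : C) : R :=
  hypergeom (- (alpha / 2)) (INR k - alpha / 2) (INR k + 1) (Cmod z ^ 2).

Definition real_kernel_mapping (alpha : R) (c : Z -> C) (z : C) : C :=
  (CSeries (fun k => c (Z.of_nat k) * kernel_factor alpha k z * z ^ k)
   + CSeries (fun j => c (- Z.of_nat (S j))%Z
                       * kernel_factor alpha (S j) z * Cconj z ^ S j))%C.

(* Main.v *)
Require Import Defs.
From Stdlib Require Import Reals ZArith Lra Lia.
From Coquelicot Require Import Coquelicot.

(* With [m = alpha/2], the hypergeometric series terminates:
   [F(-m, k-m; k+1; x)] is the sum over [n <= m] of [B_n Q_n(k) x^n], where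
   [Q_n(k)] is the product over [i < n] of
   [(k-m+i) / (k+1+i) = 1 - (m+1) / (k+1+i)].  The multiplier [1/(k+1+i)],
   applied to the terms of degree [k] of [v], yields the mean of [t^i v(t z)]
   over [0 <= t <= 1], hence preserves Lipschitz continuity, and therefore so
   does [Q_n].  Thus [u] is a finite sum of products of [|z|^(2n)] with
   Lipschitz functions, which are bounded on the disk.  Real and imaginary parts
   are treated separately. *)

(** * Real and imaginary parts of complex values and series *)

Definition coordinate (phi : C -> R) : Prop := phi = Re \/ phi = Im.

Lemma coordinate_plus (phi : C -> R) (x y : C) :
  coordinate phi -> phi (x + y)%C = phi x + phi y.
Proof. intros [-> | ->]; reflexivity. Qed.

Lemma coordinate_scal (phi : C -> R) (r : R) (x : C) :
  coordinate phi -> phi (RtoC r * x)%C = r * phi x.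
Proof. intros [-> | ->]; destruct x; unfold Re, Im; simpl; ring. Qed.

Lemma coordinate_minus (phi : C -> R) (x y : C) :
  coordinate phi -> phi (x - y)%C = phi x - phi y.
Proof. intros [-> | ->]; reflexivity. Qed.

Lemma coordinate_le_Cmod (phi : C -> R) (x : C) :
  coordinate phi -> Rabs (phi x) <= Cmod x.
Proof.
assert (H := Rmax_Cmod x).
intros [-> | ->]; eapply Rle_trans; try exact H; [apply Rmax_l | apply Rmax_r].
Qed.

Lemma coordinate_CSeries (phi : C -> R) (a : nat -> C) :
  coordinate phi -> phi (CSeries a) = Series (fun k => phi (a k)).
Proof. intros [-> | ->]; reflexivity. Qed.

Lemma coordinate_is_series (phi : C -> R) (a : nat -> C) (l : C) :
  coordinate phi -> @is_series C_AbsRing C_NormedModule a l ->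
  is_series (fun k => phi (a k)) (phi l).
Proof.
intros Hphi H.
assert (Hs : forall n, sum_n (fun k => phi (a k)) n = phi (sum_n a n)).
{ induction n as [|n IH].
  - now rewrite 2 sum_O.
  - now rewrite 2 sum_Sn, IH, <- coordinate_plus. }
assert (Hb := proj1 (filterlim_locally (U := C_UniformSpace) _ _) H).
apply filterlim_locally; intros eps.
generalize (Hb eps); apply filter_imp; intros n Hn.
(* Balls in [C_UniformSpace] are products of real balls, so closeness in [C] gives closeness of each
   coordinate. *)
rewrite Hs; destruct Hphi as [-> | ->]; apply Hn.
Qed.

(** * Real-valued Lipschitz functions on the disk *)

Definition lipschitz_real (f : C -> R) : Prop :=
  exists L : R, 0 <= L /\
    forall z w : C, in_disk z -> in_disk w ->
      Rabs (f z - f w) <= L * Cmod (z - w)%C.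

Lemma lipschitz_real_ext (f g : C -> R) :
  (forall z, in_disk z -> f z = g z) -> lipschitz_real f -> lipschitz_real g.
Proof.
intros E [L [HL H]]; exists L; split; [exact HL|].
intros z w Hz Hw; rewrite <- !E; auto.
Qed.

Lemma lipschitz_coordinate (phi : C -> R) (f : C -> C) :
  coordinate phi -> lipschitz_on_disk f -> lipschitz_real (fun z => phi (f z)).
Proof.
intros Hphi [L [HL H]]; exists L; split; [exact HL|].
intros z w Hz Hw; rewrite <- coordinate_minus by exact Hphi.
eapply Rle_trans; [now apply coordinate_le_Cmod | now apply H].
Qed.

Lemma lipschitz_of_coordinates (f : C -> C) :
  (forall phi, coordinate phi -> lipschitz_real (fun z => phi (f z))) ->
  lipschitz_on_disk f.
Proof.
intros H.
destruct (H Re (or_introl eq_refl)) as [L1 [HL1 H1]].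
destruct (H Im (or_intror eq_refl)) as [L2 [HL2 H2]].
exists (L1 + L2); split; [lra|]; intros z w Hz Hw.
specialize (H1 z w Hz Hw); specialize (H2 z w Hz Hw).
set (d := (f z - f w)%C).
assert (Hd : Cmod d <= Rabs (Re d) + Rabs (Im d)).
{ replace d with (RtoC (Re d) + Ci * RtoC (Im d))%C at 1
    by (destruct d as [x y]; unfold Re, Im, Ci, RtoC, Cplus, Cmult; simpl;
        f_equal; ring).
  eapply Rle_trans; [apply Cmod_triangle|].
  rewrite Cmod_mult, !Cmod_R.
  replace (Cmod Ci) with 1; [lra|].
  rewrite <- sqrt_1; unfold Cmod, Ci; f_equal; simpl; ring. }
change (Re d) with (Re (f z) - Re (f w)) in Hd.
change (Im d) with (Im (f z) - Im (f w)) in Hd.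
lra.
Qed.

Lemma lipschitz_real_scal (r : R) (f : C -> R) :
  lipschitz_real f -> lipschitz_real (fun z => r * f z).
Proof.
intros [L [HL H]]; exists (Rabs r * L); split.
- apply Rmult_le_pos; [apply Rabs_pos | exact HL].
- intros z w Hz Hw; rewrite <- Rmult_minus_distr_l, Rabs_mult, Rmult_assoc.
  apply Rmult_le_compat_l; [apply Rabs_pos | now apply H].
Qed.

Lemma lipschitz_real_plus (f g : C -> R) :
  lipschitz_real f -> lipschitz_real g -> lipschitz_real (fun z => f z + g z).
Proof.
intros [L [HL H]] [M [HM K]]; exists (L + M); split; [lra|].
intros z w Hz Hw; specialize (H z w Hz Hw); specialize (K z w Hz Hw).
replace (f z + g z - (f w + g w)) with ((f z - f w) + (g z - g w)) by ring.
eapply Rle_trans; [apply Rabs_triang | lra].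
Qed.

Lemma in_disk_0 : in_disk 0.
Proof. unfold in_disk; rewrite Cmod_0; lra. Qed.

(** Every point of the disk lies within distance 1 of the origin. Boundedness is what makes products
    of Lipschitz functions Lipschitz. *)
Lemma lipschitz_real_bounded (f : C -> R) :
  lipschitz_real f ->
  exists B, 0 <= B /\ forall z, in_disk z -> Rabs (f z) <= B.
Proof.
intros [L [HL H]]; exists (Rabs (f 0%C) + L); split.
- generalize (Rabs_pos (f 0%C)); lra.
- intros z Hz; specialize (H z 0%C Hz in_disk_0).
  replace (z - 0)%C with z in H by ring.
  assert (L * Cmod z <= L * 1)
    by (apply Rmult_le_compat_l; [exact HL | apply Rlt_le, Hz]).
  replace (f z) with (f 0%C + (f z - f 0%C)) by ring.
  eapply Rle_trans; [apply Rabs_triang | lra].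
Qed.

Lemma lipschitz_real_mult (f g : C -> R) :
  lipschitz_real f -> lipschitz_real g -> lipschitz_real (fun z => f z * g z).
Proof.
intros Hf Hg.
destruct (lipschitz_real_bounded f Hf) as [A [HA Bf]].
destruct (lipschitz_real_bounded g Hg) as [B [HB Bg]].
destruct Hf as [L [HL Hf]]; destruct Hg as [M [HM Hg]].
exists (A * M + L * B); split.
- apply Rplus_le_le_0_compat; now apply Rmult_le_pos.
- intros z w Hz Hw.
  replace (f z * g z - f w * g w)
    with (f z * (g z - g w) + (f z - f w) * g w) by ring.
  eapply Rle_trans; [apply Rabs_triang|]; rewrite !Rabs_mult.
  replace ((A * M + L * B) * Cmod (z - w))
    with (A * (M * Cmod (z - w)) + L * Cmod (z - w) * B) by ring.
  apply Rplus_le_compat; apply Rmult_le_compat; auto using Rabs_pos.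
Qed.

Lemma lipschitz_real_const (r : R) : lipschitz_real (fun _ => r).
Proof.
exists 0; split; [lra|]; intros z w _ _.
rewrite Rminus_diag, Rabs_R0; lra.
Qed.

Lemma lipschitz_real_pow (f : C -> R) (n : nat) :
  lipschitz_real f -> lipschitz_real (fun z => f z ^ n).
Proof.
intros Hf; induction n as [|n IH]; simpl.
- apply lipschitz_real_const.
- now apply lipschitz_real_mult.
Qed.

Lemma lipschitz_real_Cmod : lipschitz_real Cmod.
Proof.
exists 1; split; [lra|]; intros z w _ _; rewrite Rmult_1_l.
apply Rabs_le.
assert (H1 := Cmod_triangle (z - w) w).
assert (H2 := Cmod_triangle (- (z - w)) z).
rewrite Cmod_opp in H2.
replace (z - w + w)%C with z in H1 by ring.
replace (- (z - w) + z)%C with w in H2 by ring.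
lra.
Qed.

Lemma lipschitz_real_sum_n (f : nat -> C -> R) (m : nat) :
  (forall n, lipschitz_real (f n)) ->
  lipschitz_real (fun z => sum_n (fun n => f n z) m).
Proof.
intros H; induction m as [|m IH].
- apply lipschitz_real_ext with (f 0%nat); [|auto].
  intros z _; now rewrite sum_O.
- apply lipschitz_real_ext
    with (fun z => sum_n (fun n => f n z) m + f (S m) z).
  + intros z _; now rewrite sum_Sn.
  + now apply lipschitz_real_plus.
Qed.

(** * Series of homogeneous terms and their convergence *)

Lemma is_series_scal_real (r l : R) (a : nat -> R) :
  is_series a l -> is_series (fun k => r * a k) (r * l).
Proof. exact (is_series_scal_l (V := R_NormedModule) r a l). Qed.

Lemma ex_series_scal_real (r : R) (a : nat -> R) :
  ex_series a -> ex_series (fun k => r * a k).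
Proof. exact (ex_series_scal_l (V := R_NormedModule) r a). Qed.

(** Models a coordinate of the degree [k] part of a harmonic expansion. Along the ray through [z],
    the series of such terms is a real power series in [t]. *)
Definition homogeneous (e : nat -> C -> R) : Prop :=
  forall k (t : R) z, e k (RtoC t * z)%C = t ^ k * e k z.

Definition summable (e : nat -> C -> R) : Prop :=
  forall z, in_disk z -> ex_series (fun k => e k z).

Lemma homogeneous_mult (mu : nat -> R) (e : nat -> C -> R) :
  homogeneous e -> homogeneous (fun k z => mu k * e k z).
Proof. intros H k t z; rewrite H; ring. Qed.

(* Homogeneity turns convergence on the whole disk into convergence at a
   slightly dilated point [r * z]. *)
Lemma summable_CV_radius (e : nat -> C -> R) (z : C) :
  homogeneous e -> summable e -> in_disk z ->
  Rbar_lt 1 (CV_radius (fun k => e k z)).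
Proof.
intros He Hs Hz.
(* Since [Cmod z < 1], this choice gives both [r > 1] and [r * Cmod z < 1]. *)
set (r := 2 / (1 + Cmod z)).
assert (H0 := Cmod_ge_0 z); unfold in_disk in Hz.
assert (Hr : 1 < r) by (apply Rlt_div_r; lra).
apply Rbar_lt_le_trans with r; [exact Hr|].
apply Rbar_not_lt_le; intros Hlt.
apply (CV_disk_outside (fun k => e k z) r).
- rewrite Rabs_pos_eq by lra; exact Hlt.
- apply ex_series_lim_0.
  apply ex_series_ext with (fun k => e k (RtoC r * z)%C).
  + intros n; rewrite He; apply Rmult_comm.
  + apply Hs; unfold in_disk.
    rewrite Cmod_mult, Cmod_R, Rabs_pos_eq by lra.
    unfold r; replace (2 / (1 + Cmod z) * Cmod z)
      with (2 * Cmod z / (1 + Cmod z)) by (field; lra).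
    apply Rlt_div_l; lra.
Qed.

(** A radius of convergence above 1 makes the series of [e k z] absolutely convergent, so bounded
    multipliers are harmless by comparison. *)
Lemma summable_mult (mu : nat -> R) (e : nat -> C -> R) :
  (forall k, Rabs (mu k) <= 1) -> homogeneous e -> summable e ->
  summable (fun k z => mu k * e k z).
Proof.
intros Hmu He Hs z Hz.
apply (ex_series_le (V := R_CompleteNormedModule) _
         (fun k => Rabs (e k z * 1 ^ k))).
- intros n; change (Rabs (mu n * e n z) <= Rabs (e n z * 1 ^ n)).
  rewrite pow1, Rmult_1_r, Rabs_mult.
  rewrite <- (Rmult_1_l (Rabs (e n z))) at 2.
  apply Rmult_le_compat_r; [apply Rabs_pos | apply Hmu].
- apply CV_disk_inside; rewrite Rabs_R1; now apply summable_CV_radius.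
Qed.

(** * The averaging multiplier *)

(** The integral of [s^(k+j)] over [[0,1]]. *)
Definition mean_factor (j k : nat) : R := / INR (k + S j).

Lemma mean_factor_le_1 (j k : nat) : Rabs (mean_factor j k) <= 1.
Proof.
assert (H : 1 <= INR (k + S j)) by (apply (le_INR 1); lia).
unfold mean_factor; rewrite Rabs_pos_eq.
- rewrite <- Rinv_1; apply Rinv_le_contravar; lra.
- apply Rlt_le, Rinv_0_lt_compat; lra.
Qed.

(** Termwise, [s^(k+j+1) / (k+j+1)] is a primitive of [s^(k+j)]. *)
Lemma is_derive_mean (d : nat -> R) (j : nat) (t : R) :
  let q k := mean_factor j k * d k in
  Rbar_lt (Rabs t) (CV_radius q) ->
  is_derive (fun s => s ^ S j * PSeries q s) t (t ^ j * PSeries d t).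
Proof.
intros q Hq.
assert (Hd := is_derive_PSeries q t Hq).
(* Coefficientwise this is [(j+1) q_k + k q_k = d_k]. The shifted derivative has constant
   coefficient 0, hence the case split on the degree. *)
assert (E : PSeries d t
  = INR (S j) * PSeries q t + t * PSeries (PS_derive q) t).
{ rewrite <- PSeries_incr_1, <- PSeries_scal, <- PSeries_plus.
  - apply PSeries_ext; intros n; unfold PS_plus, PS_scal; simpl.
    assert (Hn : INR (n + S j) <> 0) by (apply not_0_INR; lia).
    destruct n as [|n].
    + unfold q, mean_factor; simpl plus; simpl plus in Hn.
      change (d 0%nat = INR (S j) * (/ INR (S j) * d 0%nat) + 0).
      field; exact Hn.
    + change (d (S n) = INR (S j) * q (S n) + INR (S n) * q (S n)).
      unfold q, mean_factor.
      rewrite <- Rmult_plus_distr_r, <- plus_INR, (Nat.add_comm (S j)).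
      field; exact Hn.
  - apply ex_pseries_scal; [apply Rmult_comm | now apply CV_radius_inside].
  - apply ex_pseries_incr_1, CV_radius_inside.
    now rewrite CV_radius_derive. }
rewrite E.
auto_derive.
- now exists (PSeries (PS_derive q) t).
- change (Derive (fun s => PSeries q s) t) with (Derive (PSeries q) t).
  rewrite (is_derive_unique _ _ _ Hd), S_INR; simpl; destruct j; simpl; ring.
Qed.

(* [sum_k e_k(z) / (k+1+j)] is the integral of [s^j * sum_k e_k(s z)] over
   [0 <= s <= 1], and each dilate of the sum inherits the Lipschitz constant. *)
Lemma mean_lipschitz (e : nat -> C -> R) (j : nat) :
  homogeneous e -> summable e ->
  lipschitz_real (fun z => Series (fun k => e k z)) ->
  lipschitz_real (fun z => Series (fun k => mean_factor j k * e k z)).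
Proof.
intros He Hs [L [HL H]]; exists L; split; [exact HL|]; intros z w Hz Hw.
set (q z k := mean_factor j k * e k z).
(* A radius strictly above 1 makes the primitives differentiable up to the endpoint [t = 1]. *)
assert (Hq : forall z, in_disk z -> Rbar_lt 1 (CV_radius (q z))).
{ intros x Hx; apply (summable_CV_radius (fun k z => q z k)).
  - now apply homogeneous_mult.
  - apply summable_mult; auto using mean_factor_le_1.
  - exact Hx. }
assert (Hdil : forall z t, in_disk z -> 0 <= t <= 1 -> in_disk (RtoC t * z)%C).
{ intros x t Hx Ht; unfold in_disk in *.
  rewrite Cmod_mult, Cmod_R, Rabs_pos_eq by lra.
  assert (t * Cmod x <= 1 * Cmod x)
    by (apply Rmult_le_compat_r; [apply Cmod_ge_0 | lra]).
  lra. }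
set (D t := t ^ S j * PSeries (q z) t - t ^ S j * PSeries (q w) t).
set (D' t := t ^ j * PSeries (fun k => e k z) t
             - t ^ j * PSeries (fun k => e k w) t).
assert (HD : forall t, 0 <= t <= 1 -> is_derive D t (D' t)).
{ intros t Ht.
  assert (Hr : forall x, in_disk x -> Rbar_lt (Rabs t) (CV_radius (q x))).
  { intros x Hx; apply Rbar_le_lt_trans with 1; [|now apply Hq].
    rewrite Rabs_pos_eq; simpl; lra. }
  apply (is_derive_minus (K := R_AbsRing) (V := R_NormedModule));
    apply is_derive_mean; now apply Hr. }
(* The mean value theorem replaces the integral: one [t] in [[0,1]] satisfies [D 1 - D 0 = D' t],
   and [D 0 = 0] because of the factor [0^(j+1)]. *)
destruct (MVT_gen D 0 1 D') as [t [Ht E]].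
- intros x; rewrite Rmin_left, Rmax_right by lra; intros Hx; apply HD; lra.
- intros x; rewrite Rmin_left, Rmax_right by lra; intros Hx.
  apply continuity_pt_filterlim.
  apply (ex_derive_continuous (K := R_AbsRing) (V := R_NormedModule)).
  exists (D' x); now apply HD.
- rewrite Rmin_left, Rmax_right in Ht by lra.
  assert (E1 : forall a, PSeries a 1 = Series a).
  { intros a; apply Series_ext; intros n; rewrite pow1; ring. }
  assert (E2 : forall x, PSeries (fun k => e k x) t
                 = Series (fun k => e k (RtoC t * x)%C)).
  { intros x; apply Series_ext; intros n; rewrite He; ring. }
  change (Rabs (Series (q z) - Series (q w)) <= L * Cmod (z - w)).
  replace (Series (q z) - Series (q w)) with (D' t).
  + unfold D'; rewrite <- Rmult_minus_distr_l, Rabs_mult, !E2.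
    rewrite Rabs_pos_eq by (apply pow_le; lra).
    assert (Hl := H _ _ (Hdil z t Hz Ht) (Hdil w t Hw Ht)).
    replace (RtoC t * z - RtoC t * w)%C with (RtoC t * (z - w))%C in Hl by ring.
    rewrite Cmod_mult, Cmod_R, (Rabs_pos_eq t) in Hl by lra.
    assert (Hc := Cmod_ge_0 (z - w)).
    assert (t * Cmod (z - w) <= 1 * Cmod (z - w))
      by (apply Rmult_le_compat_r; lra).
    assert (L * (t * Cmod (z - w)) <= L * (1 * Cmod (z - w)))
      by now apply Rmult_le_compat_l.
    assert (Hp : t ^ j <= 1) by (rewrite <- (pow1 j); apply pow_incr; lra).
    match goal with |- _ * ?a <= _ =>
      assert (t ^ j * a <= 1 * a)
        by (apply Rmult_le_compat_r; [apply Rabs_pos | exact Hp]) end.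
    lra.
  + unfold D in E; rewrite !pow1, !E1, pow_i in E by lia; lra.
Qed.

(** * The multipliers coming from the hypergeometric coefficients *)

(* This is [(k-m)_n / (k+1)_n], the [k]-dependent part of the [n]-th Taylor
   coefficient of [F(-m, k-m; k+1; x)]. *)
Fixpoint kernel_ratio (m n k : nat) : R :=
  match n with
  | O => 1
  | S i => kernel_ratio m i k - INR (S m) * (mean_factor i k * kernel_ratio m i k)
  end.

Lemma pochhammer_pos (a : R) (n : nat) : 0 < a -> 0 < pochhammer a n.
Proof.
intros Ha; induction n as [|n IH]; simpl; [lra|].
apply Rmult_lt_0_compat; [exact IH | generalize (pos_INR n); lra].
Qed.

Lemma kernel_ratioE (m n k : nat) :
  kernel_ratio m n k
  = pochhammer (INR k - INR m) n / pochhammer (INR k + 1) n.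
Proof.
assert (Hk := pos_INR k).
induction n as [|n IH]; cbn [kernel_ratio pochhammer]; [field|].
assert (Hn := pos_INR n).
assert (Hp : 0 < pochhammer (INR k + 1) n) by (apply pochhammer_pos; lra).
rewrite IH; unfold mean_factor; rewrite plus_INR, !S_INR.
field; repeat split; lra.
Qed.

(** [kernel_ratio] can exceed 1 in absolute value, so [summable_mult] is applied to one
    [mean_factor] at a time, along the recursion. *)
Lemma kernel_ratio_summable (e : nat -> C -> R) (m n : nat) :
  homogeneous e -> summable e ->
  summable (fun k z => kernel_ratio m n k * e k z).
Proof.
intros He Hs; induction n as [|n IH]; intros z Hz; cbn [kernel_ratio].
- apply ex_series_ext with (fun k => e k z); [intros k; symmetry; apply Rmult_1_l|].
  now apply Hs.
- apply ex_series_ext with (fun k => kernel_ratio m n k * e k z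
    - INR (S m) * (mean_factor n k * (kernel_ratio m n k * e k z))).
  + intros k; apply Rminus_diag_uniq; ring.
  + apply (ex_series_minus (V := R_NormedModule)); [now apply IH|].
    apply ex_series_scal_real.
    apply (summable_mult (mean_factor n)
             (fun k z => kernel_ratio m n k * e k z));
      auto using mean_factor_le_1, homogeneous_mult.
Qed.

(** Each step of the recursion subtracts a constant multiple of an averaged series, and averaging
    keeps the Lipschitz property by [mean_lipschitz]. *)
Lemma kernel_ratio_lipschitz (e : nat -> C -> R) (m n : nat) :
  homogeneous e -> summable e ->
  lipschitz_real (fun z => Series (fun k => e k z)) ->
  lipschitz_real (fun z => Series (fun k => kernel_ratio m n k * e k z)).
Proof.
intros He Hs HL; induction n as [|n IH]; cbn [kernel_ratio].
- revert HL; apply lipschitz_real_ext; intros z _.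
  apply Series_ext; intros k; ring.
- assert (Hm : homogeneous (fun k z => kernel_ratio m n k * e k z))
    by now apply homogeneous_mult.
  assert (Hr := kernel_ratio_summable e m n He Hs).
  apply lipschitz_real_ext
    with (fun z => Series (fun k => kernel_ratio m n k * e k z)
      + - INR (S m)
        * Series (fun k => mean_factor n k * (kernel_ratio m n k * e k z))).
  + intros z Hz; rewrite <- Series_scal_l, <- Series_plus.
    * apply Series_ext; intros k; ring.
    * now apply Hr.
    * apply ex_series_scal_real.
      apply (summable_mult (mean_factor n)
               (fun k z => kernel_ratio m n k * e k z));
        auto using mean_factor_le_1.
  + apply lipschitz_real_plus; [exact IH|].
    now apply lipschitz_real_scal,
      (mean_lipschitz (fun k z => kernel_ratio m n k * e k z)).
Qed.

(** * Termination of the hypergeometric series and the action of the kernel *)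

(** The product contains the factor [-m + m]. *)
Lemma pochhammer_opp_INR (m n : nat) :
  (m < n)%nat -> pochhammer (- INR m) n = 0.
Proof.
induction n as [|n IH]; intros H; simpl; [lia|].
destruct (Nat.eq_dec m n) as [-> | Hne].
- replace (- INR n + INR n) with 0 by ring; ring.
- rewrite IH by lia; ring.
Qed.

(** This is [(-1)^n] times the binomial coefficient of [m] over [n]. *)
Definition kernel_coef (m n : nat) : R := pochhammer (- INR m) n / INR (fact n).

Lemma Series_finite_support (a : nat -> R) (m : nat) :
  (forall n, (m < n)%nat -> a n = 0) -> Series a = sum_n a m.
Proof.
intros H; apply is_series_unique.
apply filterlim_ext_loc with (fun _ : nat => sum_n a m);
  [|apply filterlim_const].
exists m; intros n Hn; induction Hn as [|n Hn IH]; [reflexivity|].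
rewrite sum_Sn, H by lia; rewrite IH; symmetry; apply Rplus_0_r.
Qed.

Lemma kernel_factor_sum (alpha : R) (m k : nat) (z : C) :
  alpha / 2 = INR m ->
  kernel_factor alpha k z
  = sum_n (fun n => kernel_coef m n * (Cmod z ^ 2) ^ n * kernel_ratio m n k) m.
Proof.
intros Ha; unfold kernel_factor, hypergeom, PSeries; rewrite Ha.
assert (Hk := pos_INR k).
rewrite (Series_finite_support _ m).
- apply sum_n_ext; intros n; unfold kernel_coef; rewrite kernel_ratioE.
  assert (Hp : 0 < pochhammer (INR k + 1) n) by (apply pochhammer_pos; lra).
  apply Rminus_diag_uniq; field; split; [lra | apply INR_fact_neq_0].
- intros n Hn; rewrite pochhammer_opp_INR by exact Hn.
  unfold Rdiv; ring.
Qed.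

(** The finite sum over [n] is exchanged with the series over [k]; the powers of [Cmod z] do not
    depend on [k] and come out. *)
Lemma is_series_kernel (alpha : R) (m : nat) (e : nat -> C -> R) (z : C) :
  alpha / 2 = INR m -> homogeneous e -> summable e -> in_disk z ->
  is_series (fun k => kernel_factor alpha k z * e k z)
    (sum_n (fun n => kernel_coef m n * (Cmod z ^ 2) ^ n
                     * Series (fun k => kernel_ratio m n k * e k z)) m).
Proof.
intros Ha He Hs Hz.
assert (Hr : forall n, is_series
  (fun k => kernel_coef m n * (Cmod z ^ 2) ^ n * kernel_ratio m n k * e k z)
  (kernel_coef m n * (Cmod z ^ 2) ^ n
   * Series (fun k => kernel_ratio m n k * e k z))).
{ intros n; apply is_series_ext with (fun k => kernel_coef m n * (Cmod z ^ 2) ^ n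
    * (kernel_ratio m n k * e k z)); [intros k; symmetry; apply Rmult_assoc|].
  apply is_series_scal_real.
  now apply Series_correct, kernel_ratio_summable. }
apply is_series_ext with (fun k => sum_n (fun n =>
    kernel_coef m n * (Cmod z ^ 2) ^ n * kernel_ratio m n k) m * e k z).
{ intros k; now rewrite (kernel_factor_sum alpha m). }
(* Only the upper summation limits are generalized, so that the induction leaves the parameter [m]
   of the coefficients fixed. *)
generalize m at 3 6; intros N.
induction N as [|N IH].
- rewrite sum_O; eapply is_series_ext; [|apply Hr].
  intros k; now rewrite sum_O.
- rewrite sum_Sn; eapply is_series_ext;
    [|apply (is_series_plus _ _ _ _ IH (Hr (S N)))].
  intros k; rewrite sum_Sn; apply Rminus_diag_uniq; unfold plus; simpl; ring.
Qed.

Lemma Series_kernel_lipschitz (alpha : R) (m : nat) (e : nat -> C -> R) :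
  alpha / 2 = INR m -> homogeneous e -> summable e ->
  lipschitz_real (fun z => Series (fun k => e k z)) ->
  lipschitz_real (fun z => Series (fun k => kernel_factor alpha k z * e k z)).
Proof.
intros Ha He Hs HL.
apply lipschitz_real_ext with (fun z => sum_n (fun n =>
  kernel_coef m n * (Cmod z ^ 2) ^ n
  * Series (fun k => kernel_ratio m n k * e k z)) m).
- intros z Hz; symmetry; now apply is_series_unique, is_series_kernel.
- apply lipschitz_real_sum_n; intros n.
  apply lipschitz_real_mult; [|now apply kernel_ratio_lipschitz].
  apply lipschitz_real_scal, lipschitz_real_pow, lipschitz_real_pow.
  exact lipschitz_real_Cmod.
Qed.

(** * The terms of the harmonic mapping and the conclusion *)

Definition analytic_term (phi : C -> R) (c : Z -> C) (k : nat) (z : C) : R :=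
  phi (c (Z.of_nat k) * z ^ k)%C.

(** The zero term in degree 0 makes the index equal to the degree, so that both families can be
    added degree by degree. *)
Definition conj_term (phi : C -> R) (c : Z -> C) (k : nat) (z : C) : R :=
  match k with
  | O => 0
  | S j => phi (c (- Z.of_nat (S j))%Z * Cconj z ^ S j)%C
  end.

Lemma coordinate_dilate (phi : C -> R) (a z : C) (t : R) (k : nat) :
  coordinate phi -> phi (a * (RtoC t * z) ^ k)%C = t ^ k * phi (a * z ^ k)%C.
Proof.
intros Hphi; rewrite Cpow_mult_l, <- RtoC_pow, <- coordinate_scal by exact Hphi.
f_equal; ring.
Qed.

Lemma analytic_term_homogeneous (phi : C -> R) (c : Z -> C) :
  coordinate phi -> homogeneous (analytic_term phi c).
Proof. intros Hphi k t z; now apply coordinate_dilate. Qed.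

Lemma conj_term_homogeneous (phi : C -> R) (c : Z -> C) :
  coordinate phi -> homogeneous (conj_term phi c).
Proof.
intros Hphi [|j] t z; unfold conj_term; [ring|].
replace (Cconj (RtoC t * z)) with (RtoC t * Cconj z)%C
  by (destruct z; unfold Cconj, RtoC, Cmult; simpl; f_equal; ring).
now apply coordinate_dilate.
Qed.

(** Both halves of the mapping carry the same kernel factor in each degree. [Series] is total, so
    merging them requires convergence, which [is_series_kernel] supplies. *)
Lemma coordinate_real_kernel_mapping
    (phi : C -> R) (alpha : R) (c : Z -> C) (z : C) (m : nat) :
  alpha / 2 = INR m -> coordinate phi -> in_disk z ->
  summable (analytic_term phi c) -> summable (conj_term phi c) ->
  phi (real_kernel_mapping alpha c z)
  = Series (fun k => kernel_factor alpha k z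
                     * (analytic_term phi c k z + conj_term phi c k z)).
Proof.
intros Ha Hphi Hz H1 H2.
assert (K1 := is_series_kernel alpha m _ z Ha
                (analytic_term_homogeneous phi c Hphi) H1 Hz).
assert (K2 := is_series_kernel alpha m _ z Ha
                (conj_term_homogeneous phi c Hphi) H2 Hz).
apply ex_intro in K1; apply ex_intro in K2.
rewrite (Series_ext _ (fun k => kernel_factor alpha k z * analytic_term phi c k z
  + kernel_factor alpha k z * conj_term phi c k z)) by (intros; ring).
rewrite Series_plus by assumption.
rewrite (Series_incr_1 (fun k => kernel_factor alpha k z * conj_term phi c k z))
  by assumption.
unfold real_kernel_mapping; rewrite coordinate_plus, !coordinate_CSeries by exact Hphi.
cbn [conj_term]; rewrite Rmult_0_r, Rplus_0_l.
f_equal; apply Series_ext; intros k; unfold analytic_term;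
  rewrite <- coordinate_scal by exact Hphi; f_equal; ring.
Qed.

Theorem theorem3p1 :
  forall (alpha : R) (h g v u : C -> C) (c : Z -> C) (p : nat),
    -1 < alpha ->
    harmonic_mapping h g v c ->
    (forall z : C, in_disk z -> u z = real_kernel_mapping alpha c z) ->
    lipschitz_on_disk v ->
    (1 <= p)%nat ->
    alpha / 2 = INR p - 1 ->
    lipschitz_on_disk u.
Proof.
intros alpha h g v u c p _ [_ [_ [_ Hv]]] Hu HL Hp Ha.
destruct p as [|m]; [lia|].
assert (Hm : alpha / 2 = INR m) by (rewrite Ha, S_INR; ring).
apply lipschitz_of_coordinates; intros phi Hphi.
set (e1 := analytic_term phi c); set (e2 := conj_term phi c).
assert (H12 : forall z, in_disk z -> exists s t : R,
  is_series (fun k => e1 k z) s /\ is_series (fun k => e2 k z) t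
  /\ phi (v z) = s + t).
{ intros z Hz; destruct (Hv z Hz) as [s [t [Hs [Ht E]]]].
  exists (phi s), (phi t); split; [|split].
  - exact (coordinate_is_series phi _ s Hphi Hs).
  (* The series for [t] starts in degree 1; prepending the zero term [e2 0 z] leaves its sum
     unchanged. *)
  - apply (is_series_decr_1 (V := R_NormedModule)).
    assert (E0 : plus (phi t) (opp (e2 0%nat z)) = phi t)
      by (unfold plus, opp; simpl; ring).
    exact (eq_ind_r (is_series (fun k => e2 (S k) z))
             (coordinate_is_series phi _ t Hphi Ht) E0).
  - now rewrite E, coordinate_plus. }
assert (H1 : summable e1).
{ intros z Hz; destruct (H12 z Hz) as [s [_ [H _]]]; now exists s. }
assert (H2 : summable e2).
{ intros z Hz; destruct (H12 z Hz) as [_ [t [_ [H _]]]]; now exists t. }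
(* The two families stay together: the Lipschitz hypothesis concerns [v], whose degree [k] part is
   [e1 k + e2 k], and not its analytic and conjugate parts separately. *)
apply lipschitz_real_ext
  with (fun z => Series (fun k => kernel_factor alpha k z * (e1 k z + e2 k z))).
{ intros z Hz; rewrite Hu by exact Hz; symmetry.
  now apply coordinate_real_kernel_mapping with m. }
apply (Series_kernel_lipschitz alpha m (fun k z => e1 k z + e2 k z)); [exact Hm| | |].
- intros k t z; unfold e1, e2.
  rewrite analytic_term_homogeneous, conj_term_homogeneous by exact Hphi; ring.
- intros z Hz; apply (ex_series_plus (V := R_NormedModule)); auto.
- generalize (lipschitz_coordinate phi v Hphi HL); apply lipschitz_real_ext.
  intros z Hz; destruct (H12 z Hz) as [s [t [Hs [Ht ->]]]].
  symmetry; apply is_series_unique.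
  now apply (is_series_plus (V := R_NormedModule)).
Qed.
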